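(* Let $\mathcal{C}$ be a multitensor category, $D$ a coalgebra in $\mathcal{C}$, and $M,N\in D\text{-}\mathrm{Comod}_{\mathcal{C}}$. Then the internal Hom of $M$ and $N$ in the right $\mathcal{C}$-module category $D\text{-}\mathrm{Comod}_{\mathcal{C}}$ is $\underline{\mathrm{Hom}}(M,N)={}^*M\,\square_D^{\mathcal{C}}N$; that is, the functor ${}^*M\,\square_D^{\mathcal{C}}\,\bullet:D\text{-}\mathrm{Comod}_{\mathcal{C}}\to\mathcal{C}$ is a right adjoint of $M\otimes\bullet:\mathcal{C}\to D\text{-}\mathrm{Comod}_{\mathcal{C}}$.
   Context: Monoidal categories are taken strict; multitensor categories are in the sense of Etingof–Gelaki–Nikshych–Ostrik. The right dual ${}^*X$ of $X$ has $ev'_X:X\otimes{}^*X\to1$ and $coev'_X:1\to{}^*X\otimes X$. $D\text{-}\mathrm{Comod}_{\mathcal{C}}$ is the category of left $D$-comodules in $\mathcal{C}$, a right $\mathcal{C}$-module category by $(M,\rho_M)\otimes X=(M\otimes X,\rho_M\otimes id_X)$. The internal Hom $\underline{\mathrm{Hom}}(M,N)\in\mathcal{C}$ is the object representing $X\mapsto\mathrm{Hom}_{D\text{-}\mathrm{Comod}_{\mathcal{C}}}(M\otimes X,N)$. For a right $D$-comodule $(P,\rho_P)$ and a left $D$-comodule $(N,\rho_N)$ in $\mathcal{C}$, the cotensor product $P\,\square_D^{\mathcal{C}}N$ is the kernel of $\rho_P\otimes id_N-id_P\otimes\rho_N:P\otimes N\to P\otimes D\otimes N$. For $(M,\rho_M)\in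 D\text{-}\mathrm{Comod}_{\mathcal{C}}$, ${}^*M$ is a right $D$-comodule via $\rho_{{}^*M}=(id_{{}^*M}\otimes id_D\otimes ev'_M)(id_{{}^*M}\otimes\rho_M\otimes id_{{}^*M})(coev'_M\otimes id_{{}^*M}):{}^*M\to{}^*M\otimes D$. *)

(* Defs.v *)
From HB Require Import structures.
From mathcomp Require Import all_boot all_algebra.
From Stdlib Require Import ProofIrrelevance.

Set Implicit Arguments.
Unset Strict Implicit.
Unset Printing Implicit Defensive.

Import GRing.Theory.
Local Open Scope ring_scope.

Declare Scope cat_scope.
Delimit Scope cat_scope with cat.
Local Open Scope cat_scope.

Reserved Notation "g ∘ f" (at level 40, left associativity).
Reserved Notation "X ⊗ Y" (at level 37, left associativity).
Reserved Notation "f ⊗ₘ g" (at level 37, left associativity).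

Record category := Category {
  cobj :> Type;
  chom : cobj -> cobj -> Type;
  cidm : forall X, chom X X;
  ccomp : forall X Y Z, chom Y Z -> chom X Y -> chom X Z;
  ccompA : forall X Y Z T (h : chom Z T) (g : chom Y Z) (f : chom X Y),
    ccomp h (ccomp g f) = ccomp (ccomp h g) f;
  ccomp1f : forall X Y (f : chom X Y), ccomp (cidm Y) f = f;
  ccompf1 : forall X Y (f : chom X Y), ccomp f (cidm X) = f }.

Record functor (A B : category) := Functor {
  fobj :> A -> B;
  fmap : forall X Y, chom X Y -> chom (fobj X) (fobj Y);
  fmap_id : forall X, fmap (cidm X) = cidm (fobj X);
  fmap_comp : forall X Y Z (g : chom Y Z) (f : chom X Y),
    fmap (ccomp g f) = ccomp (fmap g) (fmap f) }.

Definition is_right_adjoint (A B : category) (G : functor B A)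
    (F : functor A B) : Prop :=
  exists phi : forall (X : A) (Y : B), chom (F X) Y -> chom X (G Y),
    [/\ forall X Y, bijective (@phi X Y),
        forall X X' Y (h : chom X' X) (f : chom (F X) Y),
          phi X' Y (ccomp f (fmap F h)) = ccomp (phi X Y f) h
      & forall X Y Y' (g : chom Y Y') (f : chom (F X) Y),
          phi X Y' (ccomp g f) = ccomp (fmap G g) (phi X Y f)].

Record linearCat (k : fieldType) := LinearCat {
  obj :> Type;
  hom : obj -> obj -> lmodType k;
  idm : forall X, hom X X;
  mcomp : forall X Y Z, hom Y Z -> hom X Y -> hom X Z;
  mcompA : forall X Y Z T (h : hom Z T) (g : hom Y Z) (f : hom X Y),
    mcomp h (mcomp g f) = mcomp (mcomp h g) f;
  mcomp1f : forall X Y (f : hom X Y), mcomp (idm Y) f = f;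
  mcompf1 : forall X Y (f : hom X Y), mcomp f (idm X) = f;
  mcompPl : forall X Y Z (a : k) (g g' : hom Y Z) (f : hom X Y),
    mcomp (a *: g + g') f = a *: mcomp g f + mcomp g' f;
  mcompPr : forall X Y Z (a : k) (g : hom Y Z) (f f' : hom X Y),
    mcomp g (a *: f + f') = a *: mcomp g f + mcomp g f' }.

Notation "g ∘ f" := (mcomp g f) : cat_scope.

Coercion cat_of_linear (k : fieldType) (C : linearCat k) : category :=
  @Category C (@hom k C) (@idm k C) (@mcomp k C)
    (@mcompA k C) (@mcomp1f k C) (@mcompf1 k C).

Section Linear.
Variables (k : fieldType) (C : linearCat k).
Implicit Types X Y Z : C.

Lemma mcomp_subl X Y Z (g g' : hom Y Z) (f : hom X Y) :
  (g - g') ∘ f = g ∘ f - g' ∘ f.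
Proof. by rewrite addrC -scaleN1r mcompPl scaleN1r addrC. Qed.

Lemma mcomp_subr X Y Z (g : hom Y Z) (f f' : hom X Y) :
  g ∘ (f - f') = g ∘ f - g ∘ f'.
Proof. by rewrite addrC -scaleN1r mcompPr scaleN1r addrC. Qed.

Lemma mcomp0f X Y Z (f : hom X Y) : (0 : hom Y Z) ∘ f = 0.
Proof. by rewrite -(subrr 0) mcomp_subl subrr. Qed.

Lemma mcompf0 X Y Z (g : hom Y Z) : g ∘ (0 : hom X Y) = 0.
Proof. by rewrite -(subrr 0) mcomp_subr subrr. Qed.

Definition is_zero_obj X : Prop := forall f : hom X X, f = 0.

Definition is_iso X Y (f : hom X Y) : Prop :=
  exists g : hom Y X, g ∘ f = idm X /\ f ∘ g = idm Y.

Definition is_mono X Y (f : hom X Y) : Prop :=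
  forall Z (u v : hom Z X), f ∘ u = f ∘ v -> u = v.

Definition is_kernel X Y (f : hom X Y) K (i : hom K X) : Prop :=
  f ∘ i = 0 /\
  forall Z (h : hom Z X), f ∘ h = 0 -> exists! u : hom Z K, i ∘ u = h.

Definition is_cokernel X Y (f : hom X Y) Q (q : hom Y Q) : Prop :=
  q ∘ f = 0 /\
  forall Z (h : hom Y Z), h ∘ f = 0 -> exists! u : hom Q Z, u ∘ q = h.

Record direct_sum X1 X2 := DirectSum {
  ds_obj : C;
  ds_in1 : hom X1 ds_obj;
  ds_in2 : hom X2 ds_obj;
  ds_pr1 : hom ds_obj X1;
  ds_pr2 : hom ds_obj X2;
  ds_pr1in1 : ds_pr1 ∘ ds_in1 = idm X1;
  ds_pr2in2 : ds_pr2 ∘ ds_in2 = idm X2;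
  ds_sum : ds_in1 ∘ ds_pr1 + ds_in2 ∘ ds_pr2 = idm ds_obj }.

(** K -> X -> I -> Y -> Q with K, Q a kernel and a cokernel of f, and I both a
    coimage and an image of f. *)
Record canonical_decomposition X Y (f : hom X Y) := CanonicalDecomposition {
  cd_ker : C;
  cd_im : C;
  cd_coker : C;
  cd_k : hom cd_ker X;
  cd_i : hom X cd_im;
  cd_j : hom cd_im Y;
  cd_c : hom Y cd_coker;
  cd_ji : cd_j ∘ cd_i = f;
  cd_kP : is_kernel f cd_k;
  cd_cP : is_cokernel f cd_c;
  cd_iP : is_cokernel cd_k cd_i;
  cd_jP : is_kernel cd_c cd_j }.

Definition is_simple X : Prop :=
  ~ is_zero_obj X /\
  forall Y (i : hom Y X), is_mono i -> is_zero_obj Y \/ is_iso i.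

(** A Jordan-Hölder series 0 = F 0 -> F 1 -> ... -> F n ~ X. *)
Definition has_finite_length X : Prop :=
  exists (n : nat) (F : nat -> C) (i : forall j, hom (F j) (F j.+1)),
    [/\ is_zero_obj (F 0%N),
        exists u : hom (F n) X, is_iso u
      & forall j, (j < n)%N ->
          is_mono (i j) /\
          exists (S : C) (q : hom (F j.+1) S),
            is_cokernel (i j) q /\ is_simple S].

Definition locally_finite : Prop :=
  (forall X Y, exists n : nat, inhabited (Vector.axiom n (hom X Y))) /\
  (forall X, has_finite_length X).

End Linear.

Record abelianCat (k : fieldType) := AbelianCat {
  ab_linear :> linearCat k;
  ab_zero : ab_linear;
  ab_zeroP : is_zero_obj ab_zero;
  ab_sum : forall X Y : ab_linear, direct_sum X Y;
  ab_decomp : forall (X Y : ab_linear) (f : hom X Y),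
    canonical_decomposition f }.

(** The identity of X, seen as a morphism X -> Y when X and Y are equal
    objects.  In a strict monoidal category it carries the identifications that
    are silent on paper. *)
Definition eqhom (k : fieldType) (C : linearCat k) (X Y : C) (e : X = Y) :
    hom X Y :=
  match e in _ = Z return hom X Z with erefl => idm X end.

(** Associativity and unitality of the tensor product hold as equalities, of
    objects and then of morphisms.  The pentagon and triangle axioms are
    equalities between two [eqhom]s and so follow from proof irrelevance. *)
Record strictMonoidal (k : fieldType) (C : linearCat k) := StrictMonoidal {
  tobj : C -> C -> C;
  thom : forall X X' Y Y' : C,
    hom X X' -> hom Y Y' -> hom (tobj X Y) (tobj X' Y');
  tunit : C;
  thom_id : forall X Y, thom (idm X) (idm Y) = idm (tobj X Y);
  thom_comp : forall (X X' X'' Y Y' Y'' : C) (g : hom X' X'') (f : hom X X')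
      (g' : hom Y' Y'') (f' : hom Y Y'),
    thom (g ∘ f) (g' ∘ f') = thom g g' ∘ thom f f';
  tobjA : forall X Y Z, tobj (tobj X Y) Z = tobj X (tobj Y Z);
  tobj1o : forall X, tobj tunit X = X;
  tobjo1 : forall X, tobj X tunit = X;
  thomA : forall (X X' Y Y' Z Z' : C) (f : hom X X') (g : hom Y Y')
      (h : hom Z Z'),
    eqhom (tobjA X' Y' Z') ∘ thom (thom f g) h
      = thom f (thom g h) ∘ eqhom (tobjA X Y Z);
  thom1f : forall (X X' : C) (f : hom X X'),
    eqhom (tobj1o X') ∘ thom (idm tunit) f = f ∘ eqhom (tobj1o X);
  thomf1 : forall (X X' : C) (f : hom X X'),
    eqhom (tobjo1 X') ∘ thom f (idm tunit) = f ∘ eqhom (tobjo1 X) }.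

Section Rigid.
Variables (k : fieldType) (C : linearCat k) (T : strictMonoidal C).
Local Notation "X ⊗ Y" := (tobj T X Y) : cat_scope.
Local Notation "f ⊗ₘ g" := (thom T f g) : cat_scope.
Local Notation "𝟙" := (tunit T) : cat_scope.

Record left_dual (X : C) := LeftDual {
  ld_obj : C;
  ld_ev : hom (ld_obj ⊗ X) 𝟙;
  ld_coev : hom 𝟙 (X ⊗ ld_obj);
  ld_zigzag :
    eqhom (tobjo1 T X) ∘ (idm X ⊗ₘ ld_ev) ∘ eqhom (tobjA T X ld_obj X)
      ∘ (ld_coev ⊗ₘ idm X) ∘ eqhom (esym (tobj1o T X)) = idm X;
  ld_zagzig :
    eqhom (tobj1o T ld_obj) ∘ (ld_ev ⊗ₘ idm ld_obj)
      ∘ eqhom (esym (tobjA T ld_obj X ld_obj))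
      ∘ (idm ld_obj ⊗ₘ ld_coev) ∘ eqhom (esym (tobjo1 T ld_obj))
      = idm ld_obj }.

Record right_dual (X : C) := RightDual {
  rd_obj : C;
  rd_ev : hom (X ⊗ rd_obj) 𝟙;
  rd_coev : hom 𝟙 (rd_obj ⊗ X);
  rd_zigzag :
    eqhom (tobj1o T X) ∘ (rd_ev ⊗ₘ idm X) ∘ eqhom (esym (tobjA T X rd_obj X))
      ∘ (idm X ⊗ₘ rd_coev) ∘ eqhom (esym (tobjo1 T X)) = idm X;
  rd_zagzig :
    eqhom (tobjo1 T rd_obj) ∘ (idm rd_obj ⊗ₘ rd_ev)
      ∘ eqhom (tobjA T rd_obj X rd_obj)
      ∘ (rd_coev ⊗ₘ idm rd_obj) ∘ eqhom (esym (tobj1o T rd_obj))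
      = idm rd_obj }.

Definition tensor_bilinear : Prop :=
  (forall (X X' Y Y' : C) (a : k) (f f' : hom X X') (g : hom Y Y'),
     (a *: f + f') ⊗ₘ g = a *: (f ⊗ₘ g) + f' ⊗ₘ g) /\
  (forall (X X' Y Y' : C) (a : k) (f : hom X X') (g g' : hom Y Y'),
     f ⊗ₘ (a *: g + g') = a *: (f ⊗ₘ g) + f ⊗ₘ g').

End Rigid.

Record multitensorCat (k : fieldType) := MultitensorCat {
  mt_abelian :> abelianCat k;
  mt_finite : locally_finite mt_abelian;
  mt_tensor : strictMonoidal mt_abelian;
  mt_ldual : forall X : mt_abelian, left_dual mt_tensor X;
  mt_rdual : forall X : mt_abelian, right_dual mt_tensor X;
  mt_bilinear : tensor_bilinear mt_tensor }.

Notation "X ⊗ Y" := (tobj (mt_tensor _) X Y) : cat_scope.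
Notation "f ⊗ₘ g" := (thom (mt_tensor _) f g) : cat_scope.
Notation "𝟙" := (tunit (mt_tensor _)) : cat_scope.

Section Calculus.
Variables (k : fieldType) (C : multitensorCat k).
Implicit Types X Y Z : C.

Definition tA X Y Z : (X ⊗ Y) ⊗ Z = X ⊗ (Y ⊗ Z) := tobjA (mt_tensor C) X Y Z.
Definition t1o X : 𝟙 ⊗ X = X := tobj1o (mt_tensor C) X.
Definition to1 X : X ⊗ 𝟙 = X := tobjo1 (mt_tensor C) X.

Definition heq X Y X' Y' (f : hom X Y) (f' : hom X' Y') : Prop :=
  exists (eX : X = X') (eY : Y = Y'), eqhom eY ∘ f = f' ∘ eqhom eX.

Lemma heq_eq X Y (f f' : hom X Y) : heq f f' -> f = f'.
Proof.
case=> eX [eY]; rewrite (proof_irrelevance _ eX erefl).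
by rewrite (proof_irrelevance _ eY erefl) /= mcomp1f mcompf1.
Qed.

Lemma heq_refl X Y (f : hom X Y) : heq f f.
Proof. by exists erefl, erefl; rewrite /= mcomp1f mcompf1. Qed.

Lemma eq_heq X Y (f f' : hom X Y) : f = f' -> heq f f'.
Proof. by move->; exact: heq_refl. Qed.

Lemma heq_sym X Y X' Y' (f : hom X Y) (f' : hom X' Y') : heq f f' -> heq f' f.
Proof.
case=> eX [eY]; destruct eX, eY; rewrite /= mcomp1f mcompf1 => ->.
exact: heq_refl.
Qed.

Lemma heq_trans X Y X' Y' X'' Y'' (f : hom X Y) (f' : hom X' Y')
  (f'' : hom X'' Y'') : heq f f' -> heq f' f'' -> heq f f''.
Proof.
by case=> eX [eY]; destruct eX, eY; rewrite /= mcomp1f mcompf1 => ->.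
Qed.

Lemma heq_eqhom X Y (e : X = Y) : heq (eqhom e) (idm X).
Proof. by destruct e; exact: heq_refl. Qed.

Definition comp_eq X Y Y' Z (g : hom Y' Z) (f : hom X Y) (e : Y = Y') :
  hom X Z := g ∘ eqhom e ∘ f.

Lemma heq_comp X Y Z W X' Y' Z' W' (e : Y = Z) (e' : Y' = Z')
    (g : hom Z W) (f : hom X Y) (g' : hom Z' W') (f' : hom X' Y') :
  heq g g' -> heq f f' -> heq (comp_eq g f e) (comp_eq g' f' e').
Proof.
case=> eZ [eW Hg] [eX [eY Hf]]; destruct eZ, eW, eX, eY.
rewrite (proof_irrelevance _ e e').
move: Hg Hf; rewrite /= !mcomp1f !mcompf1 => -> ->; exact: heq_refl.
Qed.

Lemma comp_heq X Y Z (g : hom Y Z) (f : hom X Y) (e : Y = Y) :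
  heq (g ∘ f) (comp_eq g f e).
Proof.
rewrite (proof_irrelevance _ e erefl) /comp_eq /= mcompf1; exact: heq_refl.
Qed.

Lemma heq_thom X X' Y Y' Z Z' W W' (f : hom X X') (g : hom Y Y')
    (f' : hom Z Z') (g' : hom W W') :
  heq f f' -> heq g g' -> heq (f ⊗ₘ g) (f' ⊗ₘ g').
Proof.
case=> eX [eX' Hf] [eY [eY' Hg]]; destruct eX, eX', eY, eY'.
by move: Hf Hg; rewrite /= !mcomp1f !mcompf1 => -> ->; exact: heq_refl.
Qed.

Lemma heq_thomA X X' Y Y' Z Z' (f : hom X X') (g : hom Y Y') (h : hom Z Z') :
  heq ((f ⊗ₘ g) ⊗ₘ h) (f ⊗ₘ (g ⊗ₘ h)).
Proof. by exists (tA X Y Z), (tA X' Y' Z'); exact: thomA. Qed.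

Lemma heq_thom1f X X' (f : hom X X') : heq (idm 𝟙 ⊗ₘ f) f.
Proof. by exists (t1o X), (t1o X'); exact: thom1f. Qed.

Lemma heq_thomf1 X X' (f : hom X X') : heq (f ⊗ₘ idm 𝟙) f.
Proof. by exists (to1 X), (to1 X'); exact: thomf1. Qed.

Lemma heq_thom_comp X Y Z W X' Y' Z' W' (e : Y = Z) (e' : Y' = Z')
    (e'' : Y ⊗ Y' = Z ⊗ Z')
    (g : hom Z W) (f : hom X Y) (g' : hom Z' W') (f' : hom X' Y') :
  comp_eq g f e ⊗ₘ comp_eq g' f' e' = comp_eq (g ⊗ₘ g') (f ⊗ₘ f') e''.
Proof.
destruct e, e'; rewrite (proof_irrelevance _ e'' erefl) /comp_eq /= !mcompf1.
exact: thom_comp.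
Qed.

Lemma comp_eqA X Y Y' Z Z' W (e1 : Y = Y') (e2 : Z = Z')
    (h : hom Z' W) (g : hom Y' Z) (f : hom X Y) :
  comp_eq h (comp_eq g f e1) e2 = comp_eq (comp_eq h g e2) f e1.
Proof. by rewrite /comp_eq !mcompA. Qed.

Lemma comp_eqf1 X Y Z (e : Y = X) (f : hom X Z) : heq (comp_eq f (idm Y) e) f.
Proof. by destruct e; rewrite /comp_eq /= !mcompf1; exact: heq_refl. Qed.

Lemma comp_eq1f X Y Z (e : Y = Z) (f : hom X Y) : heq (comp_eq (idm Z) f e) f.
Proof. by destruct e; rewrite /comp_eq /= !mcomp1f; exact: heq_refl. Qed.

Lemma heq_whiskerl X Y Y' Z W (e : Y = Y') (e' : X ⊗ Y = X ⊗ Y')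
    (g : hom Y' Z) (f : hom W Y) :
  idm X ⊗ₘ comp_eq g f e = comp_eq (idm X ⊗ₘ g) (idm X ⊗ₘ f) e'.
Proof.
rewrite -(heq_thom_comp erefl e); congr (_ ⊗ₘ _).
by rewrite /comp_eq /= !mcompf1.
Qed.

Lemma heq_whiskerr X Y Y' Z W (e : Y = Y') (e' : Y ⊗ X = Y' ⊗ X)
    (g : hom Y' Z) (f : hom W Y) :
  comp_eq g f e ⊗ₘ idm X = comp_eq (g ⊗ₘ idm X) (f ⊗ₘ idm X) e'.
Proof.
rewrite -(heq_thom_comp e erefl); congr (_ ⊗ₘ _).
by rewrite /comp_eq /= !mcompf1.
Qed.

Lemma heq_exchange X X' Y Y' (f : hom X X') (g : hom Y Y') :
  (f ⊗ₘ idm Y') ∘ (idm X ⊗ₘ g) = (idm X' ⊗ₘ g) ∘ (f ⊗ₘ idm Y).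
Proof. by rewrite -!thom_comp !mcomp1f !mcompf1. Qed.

Lemma heq_castl X Y Y' (e : Y = Y') (f : hom X Y) : heq (eqhom e ∘ f) f.
Proof. by destruct e; rewrite /= mcomp1f; exact: heq_refl. Qed.

Lemma heq_castr X X' Y (e : X = X') (f : hom X' Y) : heq (f ∘ eqhom e) f.
Proof. by destruct e; rewrite /= mcompf1; exact: heq_refl. Qed.

Lemma heq_compA X Y Y' Z Z' W (e1 e1' : Y = Y') (e2 e2' : Z = Z')
    (h : hom Z' W) (g : hom Y' Z) (f : hom X Y) :
  heq (comp_eq h (comp_eq g f e1) e2) (comp_eq (comp_eq h g e2') f e1').
Proof.
rewrite (proof_irrelevance _ e1 e1') (proof_irrelevance _ e2 e2') comp_eqA.
exact: heq_refl.
Qed.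

Lemma heq_comp_cast X Y Y' Z (e : Y = Y') (g : hom Y' Z) (f : hom X Y) :
  heq (g ∘ eqhom e ∘ f) (comp_eq g f e).
Proof. exact: heq_refl. Qed.

Lemma heq_idm X Y : X = Y -> heq (idm X) (idm Y).
Proof. by move=> e; destruct e; exact: heq_refl. Qed.

End Calculus.

Arguments tA {k C}.
Arguments t1o {k C}.
Arguments to1 {k C}.

Ltac objeq := by rewrite ?(tA, t1o, to1).
Local Notation "f ≈ g" := (heq f g) (at level 70).
Local Notation "g ⊚ f" := (comp_eq g f ltac:(objeq))
  (at level 40, left associativity, only parsing).

Local Ltac step t := apply: (heq_trans (f' := t)).

Section Duals.
Variables (k : fieldType) (C : multitensorCat k).

Definition rdual (X : C) : C := rd_obj (mt_rdual X).
Definition rdual_ev (X : C) : hom (X ⊗ rdual X) 𝟙 := rd_ev (mt_rdual X).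
Definition rdual_coev (X : C) : hom 𝟙 (rdual X ⊗ X) := rd_coev (mt_rdual X).

Lemma mate_subproof (S Z M : C) : (S ⊗ (Z ⊗ M)) ⊗ S = (S ⊗ Z) ⊗ (M ⊗ S).
Proof. objeq. Qed.

(** For r : M -> Z ⊗ M, this is (id ⊗ id_Z ⊗ ev') (id ⊗ r ⊗ id) (coev' ⊗ id)
    from the right dual of M to its tensor product with Z; for Z = D and r the
    coaction of a left D-comodule M, it is the right coaction on the dual. *)
Definition mate (M Z : C) (r : hom M (Z ⊗ M)) : hom (rdual M) (rdual M ⊗ Z) :=
  eqhom (to1 (rdual M ⊗ Z))
    ∘ ((idm (rdual M) ⊗ₘ idm Z) ⊗ₘ rdual_ev M)
    ∘ eqhom (mate_subproof (rdual M) Z M)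
    ∘ ((idm (rdual M) ⊗ₘ r) ⊗ₘ idm (rdual M))
    ∘ (rdual_coev M ⊗ₘ idm (rdual M))
    ∘ eqhom (esym (t1o (rdual M))).

Section Mate.
Variables (M Z : C).
Local Notation S := (rdual M).
Local Notation ev := (rdual_ev M).
Local Notation cv := (rdual_coev M).

Lemma zigzag : (ev ⊗ₘ idm M) ⊚ (idm M ⊗ₘ cv) ≈ idm M.
Proof.
apply: heq_trans (eq_heq (rd_zigzag (mt_rdual M))).
apply: heq_sym; apply: (heq_trans (heq_castr _ _)).
rewrite -!mcompA; apply: (heq_trans (heq_castl _ _)); rewrite mcompA.
exact: heq_comp (heq_refl _) (heq_refl _).
Qed.

Lemma zagzig : (idm S ⊗ₘ ev) ⊚ (cv ⊗ₘ idm S) ≈ idm S.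
Proof.
apply: heq_trans (eq_heq (rd_zagzig (mt_rdual M))).
apply: heq_sym; apply: (heq_trans (heq_castr _ _)).
rewrite -!mcompA; apply: (heq_trans (heq_castl _ _)); rewrite mcompA.
exact: heq_comp (heq_refl _) (heq_refl _).
Qed.

Lemma mateE (r : hom M (Z ⊗ M)) :
  mate r ≈ (idm S ⊗ₘ ((idm Z ⊗ₘ ev) ⊚ (r ⊗ₘ idm S))) ⊚ (cv ⊗ₘ idm S).
Proof.
apply: (heq_trans (heq_castr _ _)).
rewrite -!mcompA; apply: (heq_trans (heq_castl _ _)); rewrite !mcompA.
apply: (heq_trans (comp_heq _ _ _)).
apply: heq_comp (heq_refl _).
unshelve erewrite heq_whiskerl; first by objeq.
apply: heq_comp; exact: heq_thomA.
Qed.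

Lemma mate_uniq (r : hom M (Z ⊗ M)) (f : hom S (S ⊗ Z)) :
  (ev ⊗ₘ idm Z) ⊚ (idm M ⊗ₘ f) ≈ (idm Z ⊗ₘ ev) ⊚ (r ⊗ₘ idm S) ->
  f = mate r.
Proof.
move=> H; apply: heq_eq; apply: heq_sym; apply: (heq_trans (mateE r)).
have {}H := heq_thom (heq_refl (idm S)) (heq_sym H).
apply: (heq_trans (heq_comp _ _ H (heq_refl (cv ⊗ₘ idm S)))); first by objeq.
move=> e; unshelve erewrite heq_whiskerl; first by objeq.
rewrite -comp_eqA.
apply: heq_trans.
  apply: heq_comp (heq_sym (heq_thomA _ _ _)) _.
    shelve.
  apply: (@heq_trans _ _ _ _ _ _ _ _ _ ((idm (S ⊗ M) ⊗ₘ f) ∘ (cv ⊗ₘ idm S))).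
    apply: heq_sym; apply: (heq_trans (comp_heq _ _ _)); apply: heq_comp.
      by rewrite -thom_id; exact: heq_thomA.
    exact: heq_refl.
  rewrite -heq_exchange; apply: (heq_trans (comp_heq _ _ _)).
  apply: heq_comp (heq_thom1f _).
    shelve.
  rewrite -thom_id; exact: (heq_sym (heq_thomA _ _ _)).
Unshelve.
all: try objeq.
rewrite comp_eqA.
apply: heq_trans (@comp_eq1f _ _ _ (S ⊗ Z) (S ⊗ Z) erefl f).
apply: heq_comp (heq_refl _).
unshelve erewrite <- heq_whiskerr; first by objeq.
rewrite -thom_id.
exact: heq_thom zagzig (heq_refl _).
Qed.

Lemma mateK (r : hom M (Z ⊗ M)) :
  (ev ⊗ₘ idm Z) ⊚ (idm M ⊗ₘ mate r) ≈ (idm Z ⊗ₘ ev) ⊚ (r ⊗ₘ idm S).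
Proof.
set u := (X in _ ≈ X).
step ((ev ⊗ₘ idm (Z ⊗ 𝟙)) ⊚
       ((idm (M ⊗ S) ⊗ₘ u) ⊚ ((idm M ⊗ₘ cv) ⊗ₘ idm S))).
  apply: heq_comp; first by apply: heq_thom (heq_refl _) (heq_idm _); objeq.
  apply: (heq_trans (heq_thom (heq_refl _) (mateE r))).
  unshelve erewrite heq_whiskerl; first by objeq.
  apply: heq_comp; last exact: heq_sym (heq_thomA _ _ _).
  by rewrite -thom_id; exact: heq_sym (heq_thomA _ _ _).
step (u ⊚ ((ev ⊗ₘ idm (M ⊗ S)) ⊚ ((idm M ⊗ₘ cv) ⊗ₘ idm S))).
  step ((u ⊚ (ev ⊗ₘ idm (M ⊗ S))) ⊚ ((idm M ⊗ₘ cv) ⊗ₘ idm S));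
    last exact: heq_sym (heq_compA _ _ _ _ _ _ _).
  step (((ev ⊗ₘ idm (Z ⊗ 𝟙)) ∘ (idm (M ⊗ S) ⊗ₘ u))
         ⊚ ((idm M ⊗ₘ cv) ⊗ₘ idm S)).
    step (((ev ⊗ₘ idm (Z ⊗ 𝟙)) ⊚ (idm (M ⊗ S) ⊗ₘ u))
           ⊚ ((idm M ⊗ₘ cv) ⊗ₘ idm S)); first exact: heq_compA.
    by apply: heq_comp (heq_refl _); exact: heq_sym (comp_heq _ _ _).
  apply: heq_comp (heq_refl _).
  rewrite heq_exchange; apply: (heq_trans (comp_heq _ _ _)).
  exact: heq_comp (heq_thom1f _) (heq_refl _).
step (u ⊚ idm (M ⊗ S)); last exact: comp_eqf1.
apply: heq_comp (heq_refl _) _.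
step (((ev ⊗ₘ idm M) ⊚ (idm M ⊗ₘ cv)) ⊗ₘ idm S).
  unshelve erewrite heq_whiskerr; first by objeq.
  apply: heq_comp (heq_refl _).
  by rewrite -thom_id; exact: heq_sym (heq_thomA _ _ _).
by rewrite -thom_id; exact: heq_thom zigzag (heq_refl _).
Qed.

End Mate.

Lemma mate_nat (M Z Z' : C) (h : hom Z Z') (r : hom M (Z ⊗ M)) :
  (idm (rdual M) ⊗ₘ h) ∘ mate r = mate ((h ⊗ₘ idm M) ∘ r).
Proof.
set S := rdual M; apply: mate_uniq; rewrite -/S.
step ((rdual_ev M ⊗ₘ idm Z') ⊚ ((idm (M ⊗ S) ⊗ₘ h) ⊚ (idm M ⊗ₘ mate r))).
  apply: heq_comp (heq_refl _) _.
  rewrite -[idm M]mcompf1 thom_comp mcompf1.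
  apply: (heq_trans (comp_heq _ _ erefl)); apply: heq_comp (heq_refl _).
  by rewrite -thom_id; exact: heq_sym (heq_thomA _ _ _).
step (((rdual_ev M ⊗ₘ idm Z') ⊚ (idm (M ⊗ S) ⊗ₘ h)) ⊚ (idm M ⊗ₘ mate r)).
  exact: heq_compA.
step ((h ⊚ (rdual_ev M ⊗ₘ idm Z)) ⊚ (idm M ⊗ₘ mate r)).
  apply: heq_comp (heq_refl _).
  step ((rdual_ev M ⊗ₘ idm Z') ∘ (idm (M ⊗ S) ⊗ₘ h)).
    exact: heq_sym (comp_heq _ _ _).
  rewrite heq_exchange; apply: (heq_trans (comp_heq _ _ erefl)).
  exact: heq_comp (heq_thom1f _) (heq_refl _).
step (h ⊚ ((rdual_ev M ⊗ₘ idm Z) ⊚ (idm M ⊗ₘ mate r))).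
  exact: heq_sym (heq_compA _ _ _ _ _ _ _).
step (h ⊚ ((idm Z ⊗ₘ rdual_ev M) ⊚ (r ⊗ₘ idm S))).
  exact: heq_comp (heq_refl _) (mateK r).
step ((h ⊚ (idm Z ⊗ₘ rdual_ev M)) ⊚ (r ⊗ₘ idm S)); first exact: heq_compA.
step (((idm Z' ⊗ₘ rdual_ev M) ⊚ ((h ⊗ₘ idm M) ⊗ₘ idm S)) ⊚ (r ⊗ₘ idm S)).
  apply: heq_comp (heq_refl _).
  step ((h ⊗ₘ idm 𝟙) ∘ (idm Z ⊗ₘ rdual_ev M)).
    apply: heq_sym; apply: (heq_trans (comp_heq _ _ erefl)).
    exact: heq_comp (heq_thomf1 _) (heq_refl _).
  rewrite heq_exchange; apply: (heq_trans (comp_heq _ _ erefl)).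
  apply: heq_comp (heq_refl _) _.
  by rewrite -thom_id; exact: heq_sym (heq_thomA _ _ _).
step ((idm Z' ⊗ₘ rdual_ev M) ⊚ (((h ⊗ₘ idm M) ⊗ₘ idm S) ⊚ (r ⊗ₘ idm S))).
  exact: heq_sym (heq_compA _ _ _ _ _ _ _).
apply: heq_comp (heq_refl _) _.
rewrite -[in X in _ ≈ X](mcompf1 (idm S)) thom_comp.
exact: heq_sym (comp_heq _ _ _).
Qed.

Lemma mate_comp (M Z Z' : C) (r : hom M (Z ⊗ M)) (r' : hom M (Z' ⊗ M)) :
  eqhom (tA (rdual M) Z Z') ∘ (mate r ⊗ₘ idm Z') ∘ mate r' =
  mate (eqhom (esym (tA Z Z' M)) ∘ (idm Z ⊗ₘ r') ∘ r).
Proof.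
set S := rdual M; apply: mate_uniq; rewrite -/S.
step (((rdual_ev M ⊗ₘ idm Z) ⊗ₘ idm Z') ⊚
       (((idm M ⊗ₘ mate r) ⊗ₘ idm Z') ⊚ (idm M ⊗ₘ mate r'))).
  apply: heq_comp.
    by rewrite -thom_id; exact: heq_sym (heq_thomA _ _ _).
  step (idm M ⊗ₘ ((mate r ⊗ₘ idm Z') ∘ mate r')).
    by apply: heq_thom (heq_refl _) _; rewrite -mcompA; exact: heq_castl.
  rewrite -[idm M]mcompf1 thom_comp mcompf1.
  apply: (heq_trans (comp_heq _ _ erefl)); apply: heq_comp (heq_refl _).
  exact: heq_sym (heq_thomA _ _ _).
step ((((rdual_ev M ⊗ₘ idm Z) ⊗ₘ idm Z') ⊚ ((idm M ⊗ₘ mate r) ⊗ₘ idm Z'))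
       ⊚ (idm M ⊗ₘ mate r')); first exact: heq_compA.
step (((idm Z ⊗ₘ (rdual_ev M ⊗ₘ idm Z')) ⊚ (r ⊗ₘ idm (S ⊗ Z')))
       ⊚ (idm M ⊗ₘ mate r')).
  apply: heq_comp (heq_refl _).
  step (((rdual_ev M ⊗ₘ idm Z) ⊚ (idm M ⊗ₘ mate r)) ⊗ₘ idm Z').
    by unshelve erewrite heq_whiskerr; [objeq | exact: heq_comp (heq_refl _) (heq_refl _)].
  apply: (heq_trans (heq_thom (mateK r) (heq_refl _))).
  unshelve erewrite heq_whiskerr; first by objeq.
  apply: heq_comp; first exact: heq_thomA.
  by rewrite -thom_id; exact: heq_thomA.
step ((idm Z ⊗ₘ (rdual_ev M ⊗ₘ idm Z')) ⊚
       ((r ⊗ₘ idm (S ⊗ Z')) ⊚ (idm M ⊗ₘ mate r'))).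
  exact: heq_sym (heq_compA _ _ _ _ _ _ _).
step ((idm Z ⊗ₘ (rdual_ev M ⊗ₘ idm Z')) ⊚
       ((idm Z ⊗ₘ (idm M ⊗ₘ mate r')) ⊚ (r ⊗ₘ idm S))).
  apply: heq_comp (heq_refl _) _.
  step ((r ⊗ₘ idm (S ⊗ Z')) ∘ (idm M ⊗ₘ mate r')).
    exact: heq_sym (comp_heq _ _ _).
  rewrite heq_exchange; apply: (heq_trans (comp_heq _ _ erefl)).
  apply: heq_comp (heq_refl _).
  by rewrite -thom_id; exact: heq_thomA.
step (((idm Z ⊗ₘ (rdual_ev M ⊗ₘ idm Z')) ⊚ (idm Z ⊗ₘ (idm M ⊗ₘ mate r')))
       ⊚ (r ⊗ₘ idm S)); first exact: heq_compA.
step (((idm (Z ⊗ Z') ⊗ₘ rdual_ev M) ⊚ ((idm Z ⊗ₘ r') ⊗ₘ idm S)) ⊚ (r ⊗ₘ idm S)).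
  apply: heq_comp (heq_refl _).
  step (idm Z ⊗ₘ ((rdual_ev M ⊗ₘ idm Z') ⊚ (idm M ⊗ₘ mate r'))).
    by unshelve erewrite heq_whiskerl; [objeq | exact: heq_comp (heq_refl _) (heq_refl _)].
  apply: (heq_trans (heq_thom (heq_refl _) (mateK r'))).
  unshelve erewrite heq_whiskerl; first by objeq.
  apply: heq_comp; last exact: heq_sym (heq_thomA _ _ _).
  by rewrite -thom_id; exact: heq_sym (heq_thomA _ _ _).
step ((idm (Z ⊗ Z') ⊗ₘ rdual_ev M) ⊚ (((idm Z ⊗ₘ r') ⊗ₘ idm S) ⊚ (r ⊗ₘ idm S))).
  exact: heq_sym (heq_compA _ _ _ _ _ _ _).
apply: heq_comp (heq_refl _) _.
step (((idm Z ⊗ₘ r') ∘ r) ⊗ₘ idm S).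
  rewrite -[in X in _ ≈ X](mcompf1 (idm S)) thom_comp.
  exact: heq_sym (comp_heq _ _ _).
apply: heq_thom (heq_refl _); rewrite -mcompA; exact: heq_sym (heq_castl _ _).
Qed.

Lemma mate_unit (M : C) :
  mate (eqhom (esym (t1o M))) = eqhom (esym (to1 (rdual M))).
Proof.
symmetry; apply: mate_uniq.
step (rdual_ev M ⊚ idm (M ⊗ rdual M)).
  apply: heq_comp (heq_thomf1 _) _.
  by rewrite -thom_id; exact: heq_thom (heq_refl _) (heq_eqhom _).
apply: heq_sym; apply: heq_comp (heq_thom1f _) _.
by rewrite -thom_id; exact: heq_thom (heq_eqhom _) (heq_refl _).
Qed.

End Duals.

Record coalgebra (k : fieldType) (C : multitensorCat k) := Coalgebra {
  coalg_obj :> C;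
  comult : hom coalg_obj (coalg_obj ⊗ coalg_obj);
  counit : hom coalg_obj 𝟙;
  comultA :
    eqhom (tA coalg_obj coalg_obj coalg_obj)
      ∘ (comult ⊗ₘ idm coalg_obj) ∘ comult
    = (idm coalg_obj ⊗ₘ comult) ∘ comult;
  counitl : eqhom (t1o coalg_obj) ∘ (counit ⊗ₘ idm coalg_obj) ∘ comult
    = idm coalg_obj;
  counitr : eqhom (to1 coalg_obj) ∘ (idm coalg_obj ⊗ₘ counit) ∘ comult
    = idm coalg_obj }.

Section Comodules.
Variables (k : fieldType) (C : multitensorCat k) (D : coalgebra C).

Record left_comodule := LeftComodule {
  lc_obj :> C;
  lc_coact : hom lc_obj (D ⊗ lc_obj);
  lc_coactA : eqhom (tA D D lc_obj) ∘ (comult D ⊗ₘ idm lc_obj) ∘ lc_coact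
    = (idm D ⊗ₘ lc_coact) ∘ lc_coact;
  lc_counit : eqhom (t1o lc_obj) ∘ (counit D ⊗ₘ idm lc_obj) ∘ lc_coact
    = idm lc_obj }.

Record right_comodule := RightComodule {
  rc_obj :> C;
  rc_coact : hom rc_obj (rc_obj ⊗ D);
  rc_coactA : eqhom (tA rc_obj D D) ∘ (rc_coact ⊗ₘ idm D) ∘ rc_coact
    = (idm rc_obj ⊗ₘ comult D) ∘ rc_coact;
  rc_counit : eqhom (to1 rc_obj) ∘ (idm rc_obj ⊗ₘ counit D) ∘ rc_coact
    = idm rc_obj }.

Record comod_hom (M N : left_comodule) := ComodHom {
  ch_hom :> hom M N;
  ch_comm : (idm D ⊗ₘ ch_hom) ∘ lc_coact M = lc_coact N ∘ ch_hom }.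

Lemma comod_hom_eq (M N : left_comodule) (f g : comod_hom M N) :
  ch_hom f = ch_hom g -> f = g.
Proof.
case: f g => [f pf] [g pg] /= e; case: _ / e in pg *.
by rewrite (eq_irrelevance pf pg).
Qed.

Lemma comod_id_subproof (M : left_comodule) :
  (idm D ⊗ₘ idm M) ∘ lc_coact M = lc_coact M ∘ idm M.
Proof. by rewrite thom_id mcomp1f mcompf1. Qed.

Lemma comod_comp_subproof (M N P : left_comodule) (g : comod_hom N P)
    (f : comod_hom M N) :
  (idm D ⊗ₘ (g ∘ f)) ∘ lc_coact M = lc_coact P ∘ (g ∘ f).
Proof.
by rewrite -[idm D]mcompf1 thom_comp -mcompA ch_comm !mcompA ch_comm.
Qed.

Definition comod_id M : comod_hom M M := ComodHom (comod_id_subproof M).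

Definition comod_comp M N P (g : comod_hom N P) (f : comod_hom M N) :
  comod_hom M P := ComodHom (comod_comp_subproof g f).

Lemma comod_compA M N P Q (h : comod_hom P Q) (g : comod_hom N P)
    (f : comod_hom M N) :
  comod_comp h (comod_comp g f) = comod_comp (comod_comp h g) f.
Proof. by apply: comod_hom_eq; exact: mcompA. Qed.

Lemma comod_comp1f M N (f : comod_hom M N) : comod_comp (comod_id N) f = f.
Proof. by apply: comod_hom_eq; exact: mcomp1f. Qed.

Lemma comod_compf1 M N (f : comod_hom M N) : comod_comp f (comod_id M) = f.
Proof. by apply: comod_hom_eq; exact: mcompf1. Qed.

Definition Comod : category := Category comod_compA comod_comp1f comod_compf1.

Definition act_coact (M : left_comodule) (X : C) : hom (M ⊗ X) (D ⊗ (M ⊗ X)) :=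
  eqhom (tA D M X) ∘ (lc_coact M ⊗ₘ idm X).

Lemma act_coactA (M : left_comodule) (X : C) :
  eqhom (tA D D (M ⊗ X)) ∘ (comult D ⊗ₘ idm (M ⊗ X)) ∘ act_coact M X
    = (idm D ⊗ₘ act_coact M X) ∘ act_coact M X.
Proof.
apply: heq_eq; rewrite -mcompA; apply: (heq_trans (heq_castl _ _)).
step (((comult D ⊗ₘ idm M) ∘ lc_coact M) ⊗ₘ idm X).
  rewrite -(mcompf1 (idm X)) thom_comp /act_coact mcompA.
  apply: (heq_trans (heq_comp_cast _ _ _)); apply: heq_sym.
  apply: (heq_trans (comp_heq _ _ erefl)); apply: heq_comp (heq_refl _).
  by rewrite -(thom_id (mt_tensor C) M X); exact: heq_thomA.
apply: heq_sym.
step (((idm D ⊗ₘ lc_coact M) ∘ lc_coact M) ⊗ₘ idm X); last first.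
  rewrite -lc_coactA -mcompA; apply: heq_thom (heq_refl _).
  exact: heq_castl.
step (((idm D ⊗ₘ lc_coact M) ⊗ₘ idm X) ∘ (lc_coact M ⊗ₘ idm X)); last first.
  by rewrite -thom_comp mcompf1; exact: heq_refl.
rewrite {2}/act_coact mcompA; apply: (heq_trans (heq_comp_cast _ _ _)).
apply: heq_sym; apply: (heq_trans (comp_heq _ _ erefl)).
apply: heq_comp (heq_refl _); apply: (heq_trans (heq_thomA _ _ _)).
exact: heq_thom (heq_refl _) (heq_sym (heq_castl _ _)).
Qed.

Lemma act_counit (M : left_comodule) (X : C) :
  eqhom (t1o (M ⊗ X)) ∘ (counit D ⊗ₘ idm (M ⊗ X)) ∘ act_coact M X
    = idm (M ⊗ X).
Proof.
apply: heq_eq; rewrite -mcompA; apply: (heq_trans (heq_castl _ _)).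
step (((counit D ⊗ₘ idm M) ∘ lc_coact M) ⊗ₘ idm X); last first.
  have -> : idm (M ⊗ X) =
      (eqhom (t1o M) ∘ ((counit D ⊗ₘ idm M) ∘ lc_coact M)) ⊗ₘ idm X.
    by rewrite mcompA lc_counit thom_id.
  by apply: heq_thom (heq_refl _); exact: heq_sym (heq_castl _ _).
step (((counit D ⊗ₘ idm M) ⊗ₘ idm X) ∘ (lc_coact M ⊗ₘ idm X)); last first.
  by rewrite -thom_comp mcompf1; exact: heq_refl.
rewrite /act_coact mcompA; apply: (heq_trans (heq_comp_cast _ _ _)).
apply: heq_sym; apply: (heq_trans (comp_heq _ _ erefl)).
by apply: heq_comp (heq_refl _); rewrite -thom_id; exact: heq_thomA.
Qed.

Definition act (M : left_comodule) (X : C) : left_comodule :=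
  LeftComodule (act_coactA M X) (act_counit M X).

Lemma act_hom_subproof (M N : left_comodule) (X Y : C) (f : comod_hom M N)
    (g : hom X Y) :
  (idm D ⊗ₘ (f ⊗ₘ g)) ∘ lc_coact (act M X) = lc_coact (act N Y) ∘ (f ⊗ₘ g).
Proof.
rewrite /= /act_coact mcompA -thomA -!mcompA -!thom_comp ch_comm.
by rewrite mcomp1f mcompf1.
Qed.

Definition act_hom (M N : left_comodule) (X Y : C) (f : comod_hom M N)
    (g : hom X Y) : comod_hom (act M X) (act N Y) :=
  @ComodHom (act M X) (act N Y) (f ⊗ₘ g) (act_hom_subproof f g).

Lemma act_hom_id M X : act_hom (comod_id M) (idm X) = comod_id (act M X).
Proof. by apply: comod_hom_eq; exact: thom_id. Qed.

Lemma act_hom_comp M N P X Y Z (g : comod_hom N P) (f : comod_hom M N)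
    (v : hom Y Z) (u : hom X Y) :
  act_hom (comod_comp g f) (v ∘ u) = comod_comp (act_hom g v) (act_hom f u).
Proof. by apply: comod_hom_eq; exact: thom_comp. Qed.

Lemma act_functor_comp (M : left_comodule) (X Y Z : C) (v : hom Y Z)
    (u : hom X Y) :
  act_hom (comod_id M) (v ∘ u)
  = comod_comp (act_hom (comod_id M) v) (act_hom (comod_id M) u).
Proof.
by rewrite -act_hom_comp; congr act_hom; apply: comod_hom_eq; rewrite /= mcompf1.
Qed.

Definition act_functor (M : left_comodule) : functor C Comod :=
  @Functor C Comod (act M) (fun X Y => @act_hom M M X Y (comod_id M))
    (act_hom_id M) (@act_functor_comp M).

Definition is_internal_hom (M N : left_comodule) (E : C) : Prop :=
  exists phi : forall X : C, comod_hom (act M X) N -> hom X E,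
    (forall X, bijective (phi X)) /\
    (forall (X X' : C) (h : hom X' X) (f : comod_hom (act M X) N),
       phi X' (comod_comp f (act_hom (comod_id M) h)) = phi X f ∘ h).

Implicit Types (P : right_comodule) (N : left_comodule).

Definition cotensor_map (P : right_comodule) (N : left_comodule) :
    hom (P ⊗ N) (P ⊗ (D ⊗ N)) :=
  eqhom (tA P D N) ∘ (rc_coact P ⊗ₘ idm N) - (idm P ⊗ₘ lc_coact N).

Definition cotensor (P : right_comodule) (N : left_comodule) : C :=
  cd_ker (ab_decomp (cotensor_map P N)).

Definition cotensor_incl (P : right_comodule) (N : left_comodule) :
    hom (cotensor P N) (P ⊗ N) :=
  cd_k (ab_decomp (cotensor_map P N)).

Lemma cotensor_inclP P N : is_kernel (cotensor_map P N) (cotensor_incl P N).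
Proof. exact: cd_kP. Qed.

Lemma cotensor_lift_subproof P N (Z : C) (h : hom Z (P ⊗ N)) :
  cotensor_map P N ∘ h = 0 ->
  exists u : hom Z (cotensor P N), cotensor_incl P N ∘ u == h.
Proof.
by case: (cotensor_inclP P N) => _ H /H [u [/eqP Hu _]]; exists u.
Qed.

Definition cotensor_lift P N (Z : C) (h : hom Z (P ⊗ N))
    (Hh : cotensor_map P N ∘ h = 0) : hom Z (cotensor P N) :=
  xchoose (cotensor_lift_subproof Hh).

Lemma cotensor_liftK P N (Z : C) (h : hom Z (P ⊗ N))
    (Hh : cotensor_map P N ∘ h = 0) :
  cotensor_incl P N ∘ cotensor_lift Hh = h.
Proof. exact/eqP/(xchooseP (cotensor_lift_subproof Hh)). Qed.

Lemma cotensor_incl_mono P N : is_mono (cotensor_incl P N).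
Proof.
move=> Z u v e; have [e0 H] := cotensor_inclP P N.
have H0 : cotensor_map P N ∘ (cotensor_incl P N ∘ v) = 0.
  by rewrite mcompA e0 mcomp0f.
by have [w [_ Hw]] := H _ _ H0; rewrite -(Hw _ e) -(Hw _ erefl).
Qed.

Lemma cotensor_map_nat P N N' (f : comod_hom N N') :
  cotensor_map P N' ∘ (idm P ⊗ₘ f)
    = (idm P ⊗ₘ (idm D ⊗ₘ f)) ∘ cotensor_map P N.
Proof.
rewrite /cotensor_map mcomp_subl mcomp_subr; congr (_ - _).
  rewrite -mcompA -thom_comp mcomp1f mcompf1 mcompA -thomA -mcompA -thom_comp.
  by rewrite thom_id mcomp1f mcompf1.
by rewrite -!thom_comp ch_comm.
Qed.

Lemma cotensor_hom_subproof P N N' (f : comod_hom N N') :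
  cotensor_map P N' ∘ ((idm P ⊗ₘ f) ∘ cotensor_incl P N) = 0.
Proof.
rewrite mcompA cotensor_map_nat -mcompA; have [-> _] := cotensor_inclP P N.
exact: mcompf0.
Qed.

Definition cotensor_hom P N N' (f : comod_hom N N') :
    hom (cotensor P N) (cotensor P N') :=
  cotensor_lift (cotensor_hom_subproof P f).

Lemma cotensor_hom_id P N : cotensor_hom P (comod_id N) = idm (cotensor P N).
Proof.
by apply: (@cotensor_incl_mono P N); rewrite cotensor_liftK thom_id mcomp1f mcompf1.
Qed.

Lemma cotensor_hom_comp P N N' N'' (g : comod_hom N' N'') (f : comod_hom N N') :
  cotensor_hom P (comod_comp g f) = cotensor_hom P g ∘ cotensor_hom P f.
Proof.
apply: (@cotensor_incl_mono P N''); rewrite cotensor_liftK mcompA cotensor_liftK.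
by rewrite -mcompA cotensor_liftK mcompA -thom_comp mcompf1.
Qed.

Definition cotensor_functor (P : right_comodule) : functor Comod C :=
  @Functor Comod C (cotensor P) (@cotensor_hom P)
    (cotensor_hom_id P) (@cotensor_hom_comp P).

Lemma dual_coactA (M : left_comodule) :
  eqhom (tA (rdual M) D D) ∘ (mate (lc_coact M) ⊗ₘ idm D) ∘ mate (lc_coact M)
    = (idm (rdual M) ⊗ₘ comult D) ∘ mate (lc_coact M).
Proof.
rewrite mate_comp mate_nat -mcompA -lc_coactA; congr mate.
rewrite !mcompA; apply: heq_eq; rewrite -!mcompA.
by apply: (heq_trans (heq_castl _ _)); exact: heq_castl.
Qed.

Lemma dual_counit (M : left_comodule) :
  eqhom (to1 (rdual M)) ∘ (idm (rdual M) ⊗ₘ counit D) ∘ mate (lc_coact M)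
    = idm (rdual M).
Proof.
rewrite -mcompA mate_nat.
have -> : (counit D ⊗ₘ idm M) ∘ lc_coact M = eqhom (esym (t1o M)).
  apply: heq_eq; apply: (heq_trans _ (heq_sym (heq_eqhom _))).
  apply: heq_trans (eq_heq (lc_counit M)).
  by rewrite -mcompA; exact: heq_sym (heq_castl _ _).
rewrite mate_unit; apply: heq_eq; apply: (heq_trans (heq_castl _ _)).
by apply: (heq_trans (heq_eqhom _)); apply: heq_idm; objeq.
Qed.

Definition dual_comodule (M : left_comodule) : right_comodule :=
  RightComodule (dual_coactA M) (dual_counit M).

End Comodules.

(* Main.v *)
From mathcomp Require Import all_boot all_algebra.
Require Import Defs.

(** The isomorphism is the duality bijection between morphisms M ⊗ X -> Y and
    morphisms X -> S ⊗ Y, for S the right dual of M, restricted to comodule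
    morphisms.  Given a morphism g : X -> S ⊗ N with transpose
    f = (ev' ⊗ N) (M ⊗ g) : M ⊗ X -> N, both composites of g into S ⊗ D ⊗ N can
    be transposed to morphisms M ⊗ X -> D ⊗ N:
    - (S ⊗ rho_N) g becomes rho_N f, by naturality ([uncurry_natr]);
    - (rho_S ⊗ N) g becomes (D ⊗ f) (rho_M ⊗ X), because the coaction of S is
      the mate of that of M ([uncurry_mate]).
    As transposition is injective, f is a morphism of comodules exactly when g
    equalises the two coactions ([comod_hom_uncurryE]), that is, exactly when g
    factors, uniquely, through the kernel S □ N.  The resulting bijection
    inherits its naturality in X and in N from that of transposition. *)

Set Implicit Arguments.
Unset Strict Implicit.
Unset Printing Implicit Defensive.

Import GRing.Theory.
Local Open Scope ring_scope.
Local Open Scope cat_scope.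

Local Notation "f ≈ g" := (heq f g) (at level 70).
Local Notation "g ⊚ f" := (comp_eq g f ltac:(objeq))
  (at level 40, left associativity, only parsing).
Local Ltac step t := apply: (heq_trans (f' := t)).

Section Transposition.
Variables (k : fieldType) (C : multitensorCat k) (M : C).
Local Notation S := (rdual M).
Local Notation ev := (rdual_ev M).
Local Notation cv := (rdual_coev M).
Implicit Types X Y Z : C.

Definition curry X Y (f : hom (M ⊗ X) Y) : hom X (S ⊗ Y) :=
  (idm S ⊗ₘ f) ∘ eqhom (tA S M X) ∘ (cv ⊗ₘ idm X) ∘ eqhom (esym (t1o X)).

Definition uncurry X Y (g : hom X (S ⊗ Y)) : hom (M ⊗ X) Y :=
  eqhom (t1o Y) ∘ (ev ⊗ₘ idm Y) ∘ eqhom (esym (tA M S Y)) ∘ (idm M ⊗ₘ g).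

Lemma curryE X Y (f : hom (M ⊗ X) Y) :
  curry f ≈ (idm S ⊗ₘ f) ⊚ (cv ⊗ₘ idm X).
Proof.
apply: (heq_trans (heq_castr _ _)).
exact: heq_comp (heq_refl _) (heq_refl _).
Qed.

Lemma uncurryE X Y (g : hom X (S ⊗ Y)) :
  uncurry g ≈ (ev ⊗ₘ idm Y) ⊚ (idm M ⊗ₘ g).
Proof.
rewrite /uncurry -!mcompA; apply: (heq_trans (heq_castl _ _)); rewrite mcompA.
exact: heq_comp (heq_refl _) (heq_refl _).
Qed.

Lemma uncurry_natl X X' Y (g : hom X (S ⊗ Y)) (h : hom X' X) :
  uncurry (g ∘ h) = uncurry g ∘ (idm M ⊗ₘ h).
Proof. by rewrite /uncurry -[in RHS]mcompA -thom_comp mcomp1f. Qed.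

Lemma curry_natr X Y Y' (h : hom Y Y') (f : hom (M ⊗ X) Y) :
  curry (h ∘ f) = (idm S ⊗ₘ h) ∘ curry f.
Proof. by rewrite /curry !mcompA -thom_comp mcomp1f. Qed.

(** The zigzag identity of the dual, whiskered by X: sliding f past ev' leaves
    f composed with (ev' ⊗ M) (M ⊗ coev') ⊗ X. *)
Lemma curryK X Y : cancel (@curry X Y) (@uncurry X Y).
Proof.
move=> f; apply: heq_eq; apply: (heq_trans (uncurryE _)).
step ((ev ⊗ₘ idm Y) ⊚ ((idm (M ⊗ S) ⊗ₘ f) ⊚ ((idm M ⊗ₘ cv) ⊗ₘ idm X))).
  apply: heq_comp (heq_refl _) _.
  apply: (heq_trans (heq_thom (heq_refl _) (curryE f))).
  unshelve erewrite heq_whiskerl; first by objeq.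
  apply: heq_comp; last exact: heq_sym (heq_thomA _ _ _).
  by rewrite -thom_id; exact: heq_sym (heq_thomA _ _ _).
step (((ev ⊗ₘ idm Y) ∘ (idm (M ⊗ S) ⊗ₘ f)) ⊚ ((idm M ⊗ₘ cv) ⊗ₘ idm X)).
  step (((ev ⊗ₘ idm Y) ⊚ (idm (M ⊗ S) ⊗ₘ f)) ⊚ ((idm M ⊗ₘ cv) ⊗ₘ idm X)).
    exact: heq_compA.
  by apply: heq_comp (heq_refl _); exact: heq_sym (comp_heq _ _ _).
step ((f ⊚ (ev ⊗ₘ idm (M ⊗ X))) ⊚ ((idm M ⊗ₘ cv) ⊗ₘ idm X)).
  apply: heq_comp (heq_refl _).
  rewrite heq_exchange; apply: (heq_trans (comp_heq _ _ erefl)).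
  exact: heq_comp (heq_thom1f _) (heq_refl _).
step (f ⊚ ((ev ⊗ₘ idm (M ⊗ X)) ⊚ ((idm M ⊗ₘ cv) ⊗ₘ idm X))).
  exact: heq_sym (heq_compA _ _ _ _ _ _ _).
step (f ⊚ idm (M ⊗ X)); last exact: comp_eqf1.
apply: heq_comp (heq_refl _) _.
step (((ev ⊗ₘ idm M) ⊚ (idm M ⊗ₘ cv)) ⊗ₘ idm X).
  unshelve erewrite heq_whiskerr; first by objeq.
  apply: heq_comp (heq_refl _).
  by rewrite -thom_id; exact: heq_sym (heq_thomA _ _ _).
by rewrite -thom_id; exact: heq_thom (zigzag _) (heq_refl _).
Qed.

(** The other zigzag identity, whiskered by Y: here g slides past coev'. *)
Lemma uncurryK X Y : cancel (@uncurry X Y) (@curry X Y).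
Proof.
move=> g; apply: heq_eq; apply: (heq_trans (curryE _)).
step (((idm S ⊗ₘ (ev ⊗ₘ idm Y)) ⊚ (idm (S ⊗ M) ⊗ₘ g)) ⊚ (cv ⊗ₘ idm X)).
  apply: heq_comp (heq_refl _).
  apply: (heq_trans (heq_thom (heq_refl _) (uncurryE g))).
  unshelve erewrite heq_whiskerl; first by objeq.
  apply: heq_comp (heq_refl _) _.
  by rewrite -thom_id; exact: heq_sym (heq_thomA _ _ _).
step ((idm S ⊗ₘ (ev ⊗ₘ idm Y)) ⊚ ((idm (S ⊗ M) ⊗ₘ g) ⊚ (cv ⊗ₘ idm X))).
  exact: heq_sym (heq_compA _ _ _ _ _ _ _).
step ((idm S ⊗ₘ (ev ⊗ₘ idm Y)) ⊚ ((cv ⊗ₘ idm (S ⊗ Y)) ⊚ g)).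
  apply: heq_comp (heq_refl _) _.
  step ((idm (S ⊗ M) ⊗ₘ g) ∘ (cv ⊗ₘ idm X)).
    exact: heq_sym (comp_heq _ _ _).
  rewrite -heq_exchange; apply: (heq_trans (comp_heq _ _ erefl)).
  exact: heq_comp (heq_refl _) (heq_thom1f _).
step (((idm S ⊗ₘ (ev ⊗ₘ idm Y)) ⊚ (cv ⊗ₘ idm (S ⊗ Y))) ⊚ g).
  exact: heq_compA.
step (idm (S ⊗ Y) ⊚ g); last exact: comp_eq1f.
apply: heq_comp (heq_refl _).
step (((idm S ⊗ₘ ev) ⊚ (cv ⊗ₘ idm S)) ⊗ₘ idm Y).
  unshelve erewrite heq_whiskerr; first by objeq.
  apply: heq_comp; first exact: heq_sym (heq_thomA _ _ _).
  by rewrite -thom_id; exact: heq_sym (heq_thomA _ _ _).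
by rewrite -thom_id; exact: heq_thom (zagzig _) (heq_refl _).
Qed.

Lemma curry_natl X X' Y (f : hom (M ⊗ X) Y) (h : hom X' X) :
  curry (f ∘ (idm M ⊗ₘ h)) = curry f ∘ h.
Proof.
by apply: (can_inj (@uncurryK _ _)); rewrite uncurry_natl !curryK.
Qed.

Lemma uncurry_natr X Y Y' (h : hom Y Y') (g : hom X (S ⊗ Y)) :
  uncurry ((idm S ⊗ₘ h) ∘ g) = h ∘ uncurry g.
Proof.
by apply: (can_inj (@curryK _ _)); rewrite curry_natr !uncurryK.
Qed.

(** This is where the coaction of the dual meets that of M: by [mateK],
    evaluating after the mate of r is the same as applying r and then
    evaluating, and r slides past g. *)
Lemma uncurry_mate X Y Z (r : hom M (Z ⊗ M)) (g : hom X (S ⊗ Y)) :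
  uncurry (eqhom (tA S Z Y) ∘ (mate r ⊗ₘ idm Y) ∘ g)
    = (idm Z ⊗ₘ uncurry g) ∘ (eqhom (tA Z M X) ∘ (r ⊗ₘ idm X)).
Proof.
apply: heq_eq; apply: (heq_trans (uncurryE _)).
step ((ev ⊗ₘ idm (Z ⊗ Y)) ⊚
       (((idm M ⊗ₘ mate r) ⊗ₘ idm Y) ⊚ (idm M ⊗ₘ g))).
  apply: heq_comp (heq_refl _) _.
  step (idm M ⊗ₘ ((mate r ⊗ₘ idm Y) ∘ g)).
    by apply: heq_thom (heq_refl _) _; rewrite -mcompA; exact: heq_castl.
  rewrite -[idm M]mcompf1 thom_comp mcompf1.
  apply: (heq_trans (comp_heq _ _ erefl)); apply: heq_comp (heq_refl _).
  exact: heq_sym (heq_thomA _ _ _).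
step (((ev ⊗ₘ idm (Z ⊗ Y)) ⊚ ((idm M ⊗ₘ mate r) ⊗ₘ idm Y)) ⊚ (idm M ⊗ₘ g)).
  exact: heq_compA.
step (((idm Z ⊗ₘ (ev ⊗ₘ idm Y)) ⊚ (r ⊗ₘ idm (S ⊗ Y))) ⊚ (idm M ⊗ₘ g)).
  apply: heq_comp (heq_refl _).
  step (((ev ⊗ₘ idm Z) ⊚ (idm M ⊗ₘ mate r)) ⊗ₘ idm Y).
    unshelve erewrite heq_whiskerr; first by objeq.
    apply: heq_comp (heq_refl _).
    by rewrite -thom_id; exact: heq_sym (heq_thomA _ _ _).
  apply: (heq_trans (heq_thom (mateK r) (heq_refl _))).
  unshelve erewrite heq_whiskerr; first by objeq.
  apply: heq_comp; first exact: heq_thomA.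
  by rewrite -thom_id; exact: heq_thomA.
step ((idm Z ⊗ₘ (ev ⊗ₘ idm Y)) ⊚ ((r ⊗ₘ idm (S ⊗ Y)) ⊚ (idm M ⊗ₘ g))).
  exact: heq_sym (heq_compA _ _ _ _ _ _ _).
step ((idm Z ⊗ₘ (ev ⊗ₘ idm Y)) ⊚ ((idm Z ⊗ₘ (idm M ⊗ₘ g)) ⊚ (r ⊗ₘ idm X))).
  apply: heq_comp (heq_refl _) _.
  step ((r ⊗ₘ idm (S ⊗ Y)) ∘ (idm M ⊗ₘ g)); first exact: heq_sym (comp_heq _ _ _).
  rewrite heq_exchange; apply: (heq_trans (comp_heq _ _ erefl)).
  apply: heq_comp (heq_refl _).
  by rewrite -thom_id; exact: heq_thomA.
step (((idm Z ⊗ₘ (ev ⊗ₘ idm Y)) ⊚ (idm Z ⊗ₘ (idm M ⊗ₘ g))) ⊚ (r ⊗ₘ idm X)).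
  exact: heq_compA.
rewrite mcompA; apply: heq_comp (heq_refl _).
step (idm Z ⊗ₘ ((ev ⊗ₘ idm Y) ⊚ (idm M ⊗ₘ g))).
  unshelve erewrite heq_whiskerl; first by objeq.
  exact: heq_comp (heq_refl _) (heq_refl _).
exact: heq_thom (heq_refl _) (heq_sym (uncurryE g)).
Qed.

End Transposition.

Section InternalHom.
Variables (k : fieldType) (C : multitensorCat k) (D : coalgebra C).
Variable M : left_comodule D.
Implicit Types (X : C) (N : left_comodule D).

(** The two sides of the left equation are the transposes of the two terms of
    [cotensor_map] composed with g. *)
Lemma comod_hom_uncurryE X N (g : hom X (rdual M ⊗ N)) :
  (idm D ⊗ₘ uncurry g) ∘ lc_coact (act M X) = lc_coact N ∘ uncurry g
  <-> cotensor_map (dual_comodule M) N ∘ g = 0.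
Proof.
rewrite /cotensor_map mcomp_subl /= /act_coact -uncurry_mate -uncurry_natr.
split=> [/(can_inj (@uncurryK _ _ _ _ _)) -> | /eqP]; first exact: subrr.
by rewrite subr_eq0 => /eqP ->.
Qed.

Lemma curry_comod_hom X N (f : comod_hom (act M X) N) :
  cotensor_map (dual_comodule M) N ∘ curry (ch_hom f) = 0.
Proof. by apply/comod_hom_uncurryE; rewrite curryK; exact: ch_comm. Qed.

Lemma uncurry_cotensor X N (u : hom X (cotensor (dual_comodule M) N)) :
  cotensor_map (dual_comodule M) N ∘ (cotensor_incl (dual_comodule M) N ∘ u)
    = 0.
Proof.
by rewrite mcompA; have [-> _] := cotensor_inclP (dual_comodule M) N; exact: mcomp0f.
Qed.

Definition cotensor_curry X N (f : comod_hom (act M X) N) :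
    hom X (cotensor (dual_comodule M) N) :=
  cotensor_lift (curry_comod_hom f).

Definition cotensor_uncurry X N (u : hom X (cotensor (dual_comodule M) N)) :
    comod_hom (act M X) N :=
  ComodHom ((comod_hom_uncurryE _).2 (uncurry_cotensor u)).

Lemma cotensor_curry_bij X N : bijective (@cotensor_curry X N).
Proof.
exists (@cotensor_uncurry X N) => [f | u].
  by apply: comod_hom_eq; rewrite /= cotensor_liftK curryK.
by apply: cotensor_incl_mono; rewrite cotensor_liftK /= uncurryK.
Qed.

Lemma cotensor_curry_natl X X' N (h : hom X' X) (f : comod_hom (act M X) N) :
  cotensor_curry (comod_comp f (act_hom (comod_id M) h)) = cotensor_curry f ∘ h.
Proof.
apply: cotensor_incl_mono; rewrite mcompA !cotensor_liftK; exact: curry_natl.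
Qed.

Lemma cotensor_curry_natr X N N' (g : comod_hom N N')
    (f : comod_hom (act M X) N) :
  cotensor_curry (comod_comp g f)
    = cotensor_hom (dual_comodule M) g ∘ cotensor_curry f.
Proof.
apply: cotensor_incl_mono; rewrite mcompA !cotensor_liftK -mcompA cotensor_liftK.
exact: curry_natr.
Qed.

End InternalHom.

Theorem proposition4p7 (k : fieldType) (C : multitensorCat k) (D : coalgebra C)
    (M N : left_comodule D) :
  is_internal_hom M N (cotensor (dual_comodule M) N) /\
  is_right_adjoint (cotensor_functor (dual_comodule M)) (act_functor M).
Proof.
split.
  exists (fun X => @cotensor_curry k C D M X N); split=> [X | X X' h f].
    exact: cotensor_curry_bij.
  exact: cotensor_curry_natl.
exists (@cotensor_curry k C D M); split=> [X Y | X X' Y h f | X Y Y' g f].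
- exact: cotensor_curry_bij.
- exact: cotensor_curry_natl.
- exact: cotensor_curry_natr.
Qed.
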